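(* There exists a polynomial $p$ such that for all integers $t\ge 4$ and $d\ge 2$, no graph excluding the complete graph $K_t$ as a minor contains a distance-$d$ semi-ladder of order larger than $$ d^{\,p(t)\cdot (2d+1)^{t-1}}. $$
   Context: All graphs are finite, undirected and simple; $\mathrm{dist}$ is the shortest-path distance. For integers $d,\ell\ge 1$, $2\ell$ pairwise distinct vertices $a_1,\dots,a_\ell,b_1,\dots,b_\ell$ of a graph form a distance-$d$ semi-ladder of order $\ell$ if $\mathrm{dist}(b_i,a_j)\le d$ for all $1\le i<j\le \ell$, and $\mathrm{dist}(b_i,a_i)>d$ for every $i\in[1,\ell]$. *)

(* Defs.v *)
From HB Require Import structures.
From mathcomp Require Import all_boot all_order all_algebra.
Set Implicit Arguments.
Unset Strict Implicit.
Unset Printing Implicit Defensive.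

Record sgraph := SGraph {
  vertex :> finType;
  adj : rel vertex;
  adj_sym : symmetric adj;
  adj_irrefl : irreflexive adj }.

Notation "x -- y" := (adj x y) (at level 30).

Lemma complete_sym n : symmetric [rel i j : 'I_n | i != j].
Proof. by move=> i j /=; rewrite eq_sym. Qed.

Lemma complete_irrefl n : irreflexive [rel i j : 'I_n | i != j].
Proof. by move=> i /=; rewrite eqxx. Qed.

Definition complete (n : nat) : sgraph :=
  SGraph (@complete_sym n) (@complete_irrefl n).

Notation "''K_' n" := (complete n) (at level 8, n at level 2, format "''K_' n").

(* The subgraph of G induced by B is connected (and nonempty). *)
Definition connected_in (G : sgraph) (B : {set G}) : Prop :=
  B != set0 /\
  {in B &, forall u v, connect [rel x y | [&& x \in B, y \in B & x -- y]] u v}.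

(* H is a minor of G: there are disjoint connected branch sets in G, one per
   vertex of H, with an edge of G between any two that come from an edge of H. *)
Definition minor (H G : sgraph) : Prop :=
  exists phi : H -> {set G},
    [/\ forall x, connected_in (phi x),
        forall x y, x != y -> [disjoint phi x & phi y]
      & forall x y, x -- y -> exists u v, [/\ u \in phi x, v \in phi y & u -- v]].

Section Distance.
Variable G : sgraph.
Implicit Types u v : G.

Definition walk (n : nat) u v : bool :=
  [exists p : n.-tuple G, path (@adj G) u p && (last u p == v)].

Lemma walkP n u v :
  reflect (exists p : seq G, [/\ path (@adj G) u p, last u p = v & size p = n])
          (walk n u v).
Proof.
apply: (iffP existsP) => [[p /andP[up /eqP pv]]|[p [up pv sp]]].
  by exists p; rewrite size_tuple.
by exists (tcast sp (in_tuple p)); rewrite val_tcast up pv eqxx.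
Qed.

Lemma connect_walk u v : connect (@adj G) u v -> exists n, walk n u v.
Proof. by case/connectP=> p up pv; exists (size p); apply/walkP; exists p. Qed.

(* None stands for an infinite distance. *)
Definition dist u v : option nat :=
  if @idP (connect (@adj G) u v) is ReflectT uv then
    Some (ex_minn (connect_walk uv))
  else None.

Definition dist_le u v (d : nat) : bool :=
  if dist u v is Some n then n <= d else false.

Lemma dist_leP u v d :
  reflect (exists p : seq G, [/\ path (@adj G) u p, last u p = v & size p <= d])
          (dist_le u v d).
Proof.
rewrite /dist_le /dist; case: {-}_ / idP => [uv|nuv].
  case: ex_minnP => n n_walk min_n.
  apply: (iffP idP) => [le_nd|[q [uq qv sq]]].
    by case/walkP: n_walk => p [up pv sp]; exists p; rewrite sp.
  by apply: leq_trans sq; apply: min_n; apply/walkP; exists q.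
by constructor=> -[p [up pv _]]; case: nuv; apply/connectP; exists p.
Qed.

End Distance.

(* Indices run over 0, ..., l - 1 instead of 1, ..., l. *)
Definition semi_ladder (G : sgraph) (d l : nat) (a b : 'I_l -> G) : Prop :=
  [/\ injective a, injective b, forall i j, a i != b j,
      forall i j : 'I_l, i < j -> dist_le (b i) (a j) d
    & forall i, ~~ dist_le (b i) (a i) d].

Definition contains_semi_ladder (G : sgraph) (d l : nat) : Prop :=
  exists a b : 'I_l -> G, semi_ladder d a b.

(* Main.v *)
Require Import Defs.
From mathcomp Require Import all_boot all_order all_algebra.
Set Implicit Arguments.
Unset Strict Implicit.
Unset Printing Implicit Defensive.

(* Cut G greedily into bags: if x is in a component C of what is left, the next
   bag consists of geodesics of the remaining graph from x to a neighbour in C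
   of each earlier bag touching C.  The earlier bags touching a component are
   then pairwise adjacent, so with the component they form a clique minor, and
   there are at most t - 2 of them.  Give each vertex v as hubs the vertices at
   distance at most d from v in the graph left when their bag is chosen.  A
   counting argument on the bags bounds the number of hubs by
   c = (t - 1) (2d + 1)^(t - 1), and two vertices are at distance at most d iff
   this is witnessed by a common hub: the first bag met by a shortest path
   contains one.  Finally, b_i reaches every later a_j through one of its c hubs,
   and a hub and its distance to a_j can be fixed by pigeonhole at most c times;
   hence the order is at most (c (d + 1) + 1)^c. *)

(** * Bounded distance: metric properties and last steps of short walks *)

Section DistanceTheory.
Variable G : sgraph.
Implicit Types (u v w : G) (m n : nat).

Lemma dist_le0 u v : dist_le u v 0 = (u == v).
Proof.
apply/dist_leP/eqP => [[p [_ <-]]|->]; last by exists [::].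
by rewrite leqn0 size_eq0 => /eqP->.
Qed.

Lemma dist_le_refl u n : dist_le u u n.
Proof. by apply/dist_leP; exists [::]. Qed.

Lemma dist_le_monotone u v m n : m <= n -> dist_le u v m -> dist_le u v n.
Proof.
move=> le_mn /dist_leP[p [up pv sp]]; apply/dist_leP; exists p.
by rewrite (leq_trans sp).
Qed.

Lemma dist_le_trans u v w m n :
  dist_le u v m -> dist_le v w n -> dist_le u w (m + n).
Proof.
move=> /dist_leP[p [up pv sp]] /dist_leP[q [vq qw sq]].
apply/dist_leP; exists (p ++ q).
by split; rewrite ?cat_path ?last_cat ?pv ?up ?size_cat ?leq_add.
Qed.

Lemma dist_le_adj u v : u -- v -> dist_le u v 1.
Proof. by move=> uv; apply/dist_leP; exists [:: v]; rewrite /= uv. Qed.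

Lemma dist_le_sym u v n : dist_le u v n = dist_le v u n.
Proof.
suff imp (x y : G) : dist_le x y n -> dist_le y x n.
  by apply/idP/idP; apply: imp.
move=> /dist_leP[p [xp py sp]]; apply/dist_leP; exists (rev (belast x p)).
split; last by rewrite size_rev size_belast.
  rewrite -py rev_path; apply: sub_path xp => a b.
  by rewrite /= adj_sym.
by case: p xp py sp => [|z p] //= _ _ _; rewrite rev_cons last_rcons.
Qed.

Lemma dist_leS u v n :
  dist_le u v n.+1 -> dist_le u v n \/ exists2 w, dist_le u w n & w -- v.
Proof.
move=> /dist_leP[p []]; case: (lastP p) => [|q w] uq.
  by move=> <- _; left; apply: dist_le_refl.
rewrite last_rcons size_rcons => wv sq; right; exists (last u q).
  by apply/dist_leP; exists q; rewrite rcons_path in uq; case/andP: uq.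
by rewrite rcons_path wv in uq; case/andP: uq.
Qed.

Lemma connect_dist_le u v : connect (@adj G) u v -> exists n, dist_le u v n.
Proof.
by case/connectP=> p up pv; exists (size p); apply/dist_leP; exists p.
Qed.

Lemma dist_le_connect u v n : dist_le u v n -> connect (@adj G) u v.
Proof. by case/dist_leP=> p [up pv _]; apply/connectP; exists p. Qed.

Lemma dist_le_closed (R : {set G}) u v n :
    (forall x y, x -- y -> x \in R -> y \in R) ->
  dist_le u v n -> u \in R -> v \in R.
Proof.
move=> clR; elim: n v => [|n IHn] v.
  by rewrite dist_le0 => /eqP->.
case/dist_leS => [|[w uw wv]]; first exact: IHn.
by move=> uR; apply: clR wv (IHn _ uw uR).
Qed.

End DistanceTheory.

(** * Induced subgraphs, their components, and clique minors *)

Section Induced.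
Variable G : sgraph.
Implicit Types (R S : {set G}) (u v w : G).

Definition induced_rel R : rel G := [rel x y | [&& x \in R, y \in R & x -- y]].

Lemma induced_sym R : symmetric (induced_rel R).
Proof. by move=> x y; rewrite /induced_rel /= adj_sym andbCA. Qed.

Lemma induced_irrefl R : irreflexive (induced_rel R).
Proof. by move=> x; rewrite /induced_rel /= adj_irrefl !andbF. Qed.

(* The vertices outside R are kept, as isolated vertices. *)
Definition induced R : sgraph := SGraph (@induced_sym R) (@induced_irrefl R).

Lemma induced_connect_sym R : connect_sym (induced_rel R).
Proof. exact/sym_connect_sym/induced_sym. Qed.

Lemma induced_connect_sub R S u v :
  R \subset S -> connect (induced_rel R) u v -> connect (induced_rel S) u v.
Proof.
move=> /subsetP RS; apply: connect_sub => x y /and3P[xR yR xy].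
by apply: connect1; rewrite /induced_rel /= !RS.
Qed.

Lemma dist_le_sub R S u v n : R \subset S ->
  @dist_le (induced R) u v n -> @dist_le (induced S) u v n.
Proof.
move=> /subsetP RS /dist_leP[p [up pv sp]]; apply/dist_leP; exists p; split=> //.
by apply: sub_path up => x y /and3P[xR yR xy]; rewrite /= /induced_rel /= !RS.
Qed.

Lemma dist_le_induced R u v n :
  @dist_le (induced R) u v n -> dist_le u v n.
Proof.
move=> /dist_leP[p [up pv sp]]; apply/dist_leP; exists p; split=> //.
by apply: sub_path up => x y /and3P[].
Qed.

Lemma dist_le_in R u v n :
  @dist_le (induced R) u v n -> u \in R -> v \in R.
Proof. by apply: (@dist_le_closed (induced R)) => x y /and3P[]. Qed.

Lemma induced_distS R u v n : @dist_le (induced R) u v n.+1 ->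
  @dist_le (induced R) u v n \/
  exists w, [/\ @dist_le (induced R) u w n, w \in R, v \in R & w -- v].
Proof.
by move=> /dist_leS[|[w uw /and3P[wR vR wv]]]; [left | right; exists w].
Qed.

Lemma induced_dist_step R u w v n :
  @dist_le (induced R) u w n -> w \in R -> v \in R -> w -- v ->
  @dist_le (induced R) u v n.+1.
Proof.
move=> uw wR vR wv; rewrite -addn1; apply: dist_le_trans uw _.
by apply: dist_le_adj; rewrite /= /induced_rel /= wR vR.
Qed.

Definition component R u : {set G} := [set v | connect (induced_rel R) u v].

Lemma component_refl R u : u \in component R u.
Proof. by rewrite inE connect0. Qed.

Lemma component_subset R u : u \in R -> component R u \subset R.
Proof.
move=> uR; apply/subsetP=> v; rewrite inE.
by move=> /(@connect_dist_le (induced R))[n /dist_le_in]; apply.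
Qed.

Lemma component_sub R S u : R \subset S -> component R u \subset component S u.
Proof. by move=> RS; apply/subsetP=> v; rewrite !inE; apply: induced_connect_sub. Qed.

Lemma component_eq R u v : v \in component R u -> component R v = component R u.
Proof.
rewrite inE => uv; apply/setP=> w.
by rewrite !inE (same_connect (induced_connect_sym R) uv).
Qed.

(** A walk from [u] inside [R] meets only vertices of the component, so it survives when [R] is
    shrunk to the component. *)
Lemma component_connected R u : connected_in (component R u).
Proof.
set C := component R u.
have uC : u \in C by apply: component_refl.
have toC v : v \in C -> connect (induced_rel C) u v.
  rewrite inE => /(@connect_dist_le (induced R))[n].
  elim: n v => [|n IHn] v; first by rewrite dist_le0 => /eqP->.
  case/(@dist_leS (induced R)) => [|[w uw wv]]; first exact: IHn.
  apply: connect_trans (IHn _ uw) _.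
  have uRw := @dist_le_connect (induced R) _ _ _ uw.
  apply: connect1; case/and3P: (wv) => _ _ wv'; rewrite /induced_rel /= wv' andbT !inE uRw.
  exact: connect_trans uRw (connect1 wv).
split=> [|v w vC wC]; first by apply/set0Pn; exists u.
by apply: connect_trans (toC w wC); rewrite induced_connect_sym; apply: toC.
Qed.

Lemma star_connected_in (B : {set G}) x :
  x \in B -> {in B, forall v, connect (induced_rel B) x v} -> connected_in B.
Proof.
move=> xB xv; split=> [|v w vB wB]; first by apply/set0Pn; exists x.
by apply: connect_trans (xv w wB); rewrite induced_connect_sym; apply: xv.
Qed.

Definition adjacent (A B : {set G}) : bool :=
  [exists u in A, exists v in B, u -- v].

Lemma adjacentP (A B : {set G}) :
  reflect (exists u v, [/\ u \in A, v \in B & u -- v]) (adjacent A B).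
Proof.
apply: (iffP exists_inP) => [[u uA /exists_inP[v vB uv]]|[u [v [uA vB uv]]]].
  by exists u, v.
by exists u => //; apply/exists_inP; exists v.
Qed.

Lemma adjacent_sym (A B : {set G}) : adjacent A B = adjacent B A.
Proof.
by apply/adjacentP/adjacentP => -[u [v [uA vB]]]; rewrite adj_sym; exists v, u.
Qed.

Lemma adjacentS (A B B' : {set G}) : B \subset B' -> adjacent A B -> adjacent A B'.
Proof.
move=> /subsetP BB' /adjacentP[u [v [uA vB uv]]].
by apply/adjacentP; exists u, v; rewrite BB'.
Qed.

(** Indexing by a subset [D] of any finite type lets bags and one extra component serve as branch
    sets without being numbered. *)
Lemma clique_minor (I : finType) (D : {set I}) (B : I -> {set G}) t :
    t <= #|D| ->
    {in D, forall i, connected_in (B i)} ->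
    {in D &, forall i j, i != j -> [disjoint B i & B j]} ->
    {in D &, forall i j, i != j -> adjacent (B i) (B j)} ->
  minor 'K_t G.
Proof.
move=> tD conB disB adjB.
have inD (i : 'I_t) : enum_val (widen_ord tD i) \in D by apply: enum_valP.
have neq (i j : 'I_t) : i != j ->
    enum_val (widen_ord tD i) != enum_val (widen_ord tD j).
  apply: contraNneq => /enum_val_inj/(congr1 val) /= ij.
  exact/eqP/val_inj.
exists (fun i => B (enum_val (widen_ord tD i))); split=> [i|i j ij|i j ij].
- exact: conB.
- by apply: disB => //; apply: neq.
- by apply/adjacentP/adjB => //; apply: neq.
Qed.

End Induced.

(** * Geodesics and their intersections with balls *)

Section Geodesics.
Variable G : sgraph.

(* The path is stored as a set meeting every distance class of x at most once. *)
Lemma geodesic_set (x y : G) : connect (@adj G) x y ->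
  exists P : {set G}, [/\ x \in P, y \in P,
    {in P, forall z, connect (induced_rel P) x z},
    {in P, forall z, connect (@adj G) x z} & {in P &, injective (dist x)}].
Proof.
move=> /connect_dist_le[n].
suff: dist_le x y n -> exists P : {set G}, [/\ x \in P, y \in P,
    {in P, forall z, connect (induced_rel P) x z},
    {in P, forall z, dist_le x z n} & {in P &, injective (dist x)}].
  move=> ex /ex[P [xP yP cP dP iP]]; exists P; split=> // z zP.
  exact: dist_le_connect (dP z zP).
elim: n y => [|n IHn] y.
  rewrite dist_le0 => /eqP<-; exists [set x]; rewrite !inE eqxx; split=> //.
  - by move=> z /set1P->.
  - by move=> z /set1P->; apply: dist_le_refl.
  - by move=> z z' /set1P-> /set1P->.
move=> xy; have [xyn|nxyn] := boolP (dist_le x y n).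
  have [P [xP yP cP dP iP]] := IHn _ xyn.
  exists P; split=> // z zP; exact: dist_le_monotone (leqnSn n) (dP z zP).
have [|[w xw wy]] := dist_leS xy; first by rewrite (negPf nxyn).
have [P [xP wP cP dP iP]] := IHn _ xw.
have PS : P \subset y |: P by apply: subsetUr.
(* All of [P] is within [n] of [x] while [y] is not, so adding [y] creates no repeated distance. *)
have new z : z \in P -> dist x z <> dist x y.
  by move=> /dP; rewrite /dist_le => + e; rewrite e -/(dist_le x y n) (negPf nxyn).
exists (y |: P); rewrite !inE xP eqxx orbT; split=> //.
- move=> z /setU1P[->|zP]; last exact: induced_connect_sub PS (cP z zP).
  apply: connect_trans (induced_connect_sub PS (cP w wP)) _.
  by apply: connect1; rewrite /induced_rel /= !inE wP eqxx wy orbT.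
- move=> z /setU1P[->|zP] //; exact: dist_le_monotone (leqnSn n) (dP z zP).
- move=> z z' /setU1P[->|zP] /setU1P[->|zP'] //; last exact: iP.
  + by move=> /esym/new; case.
  + by move/new; case.
Qed.

(** If [m] is the distance from [x] to [v], the vertices counted have distance between m - d and m +
    d from [x], and each such value occurs at most once on [P]. *)
Lemma geodesic_ball (P : {set G}) x v d :
    {in P, forall z, connect (@adj G) x z} -> {in P &, injective (dist x)} ->
  #|[set w in P | dist_le v w d]| <= 2 * d + 1.
Proof.
move=> cP iP; set Q := finset _.
have [->|[w0]] := set_0Vmem Q; first by rewrite cards0.
rewrite inE => /andP[w0P vw0].
have [n0 xw0] := connect_dist_le (cP _ w0P).
have : dist_le x v (n0 + d) by apply: dist_le_trans xw0 _; rewrite dist_le_sym.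
rewrite {1}/dist_le; case xvE: (dist x v) => [m|//] _.
have near w : w \in Q -> exists j, [/\ dist x w = Some j, j <= m + d & m <= j + d].
  rewrite inE => /andP[wP vw].
  have xw : dist_le x w (m + d).
    by apply: dist_le_trans vw; rewrite /dist_le xvE.
  move: (xw); rewrite {1}/dist_le; case xwE: (dist x w) => [j|//] jmd.
  exists j; split=> //.
  have : dist_le x v (j + d).
    by apply: (@dist_le_trans _ _ w); rewrite 1?dist_le_sym // dist_le_sym /dist_le xwE.
  by rewrite /dist_le xvE.
(* Adding [d] before subtracting [m] avoids truncation; the default 0 is never reached on [Q]. *)
pose f w : 'I_(2 * d).+1 := inord (odflt 0 (dist x w) + d - m).
rewrite addn1 -[X in _ <= X]card_ord; apply: (@leq_card_in _ _ f) => w w' wQ wQ'.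
have [j [xw j1 j2]] := near w wQ; have [j' [xw' j1' j2']] := near w' wQ'.
have bnd i : i <= m + d -> i + d - m < (2 * d).+1.
  by move=> le_i; rewrite ltnS leq_subLR mul2n -addnn addnA leq_add2r.
rewrite /f xw xw' /= => /(congr1 (@nat_of_ord _)); rewrite !inordK ?bnd // => jj.
have {}jj : j = j'.
  by apply/(@addIn d); rewrite -(subnK j2) -(subnK j2') jj.
apply: iP; last by rewrite xw xw' jj.
  by move: wQ; rewrite inE => /andP[].
by move: wQ'; rewrite inE => /andP[].
Qed.

End Geodesics.

Lemma leq_card_bigcup (I T : finType) (P : pred I) (F : I -> {set T}) :
  #|\bigcup_(i | P i) F i| <= \sum_(i | P i) #|F i|.
Proof.
elim/big_rec2: _ => [|i m A _ le_m]; first by rewrite cards0.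
by apply: leq_trans (leq_card_setU _ _) _; rewrite leq_add2l.
Qed.

(** * The greedy partition into connected bags *)

Section Decomposition.
Variable G : sgraph.
Implicit Types (beta : G -> nat) (n s j : nat) (v w : G).

Definition bag beta j : {set G} := [set v | beta v == j].

Definition level beta s : {set G} := [set v | s <= beta v].

Lemma level_sub beta s s' : s' <= s -> level beta s \subset level beta s'.
Proof. by move=> le_s; apply/subsetP=> v; rewrite !inE; apply: leq_trans. Qed.

Definition touched beta s v (N : nat) : {set 'I_N} :=
  [set u : 'I_N | (u < s) && adjacent (bag beta u) (component (level beta s) v)].

(* The first n bags are beta = 0, ..., beta = n - 1, and the vertices not yet
   placed in a bag form beta = n.  The third clause is what is kept of the fact
   that a bag is a union of at most k + 1 geodesics of its level; the last one
   makes the bags touched by a component a clique minor. *)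
Definition decomposition k beta n : Prop :=
  [/\ forall v, beta v <= n,
      forall j, j < n -> connected_in (bag beta j),
      forall j v d, j < n ->
        #|[set w in bag beta j | @dist_le (induced (level beta j)) v w d]|
          <= k.+1 * (2 * d + 1)
    & forall s v u u', s <= n -> v \in level beta s -> u < s -> u' < s -> u != u' ->
        adjacent (bag beta u) (component (level beta s) v) ->
        adjacent (bag beta u') (component (level beta s) v) ->
        adjacent (bag beta u) (bag beta u')].

(** The touched bags are connected, disjoint and pairwise adjacent, and all are adjacent to the
    component; k + 1 of them together with it would give a ['K_k.+2] minor. *)
Lemma touched_card k beta n s v N :
    ~ minor 'K_k.+2 G -> decomposition k beta n -> s <= n ->
    v \in level beta s ->
  #|touched beta s v N| <= k.
Proof.
move=> noK [_ con _ cli] sn vs; rewrite leqNgt; apply/negP=> kT; apply: noK.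
pose C := component (level beta s) v.
pose B (o : option 'I_N) := if o is Some u then bag beta u else C.
pose D := None |: Some @: touched beta s v N.
have DE o : o \in D -> o = None \/
    exists u : 'I_N, [/\ o = Some u, u < s & adjacent (bag beta u) C].
  case/setU1P=> [->|/imsetP[u + ->]]; first by left.
  by rewrite inE => /andP[us uC]; right; exists u.
have disC (u : 'I_N) : u < s -> [disjoint bag beta u & C].
  move=> us; rewrite disjoints_subset; apply/subsetP=> w; rewrite !inE => /eqP wu.
  apply/negP=> /(@connect_dist_le (induced _))[m /dist_le_in]; move=> /(_ vs).
  by rewrite inE wu leqNgt us.
apply: (@clique_minor G _ D B).
- have noneD : None \notin [set Some u | u in touched beta s v N].
    by apply/imsetP=> -[].
  by rewrite cardsU1 noneD card_imset // => ? ? [].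
- move=> o /DE[->|[u [-> us _]]]; first exact: component_connected.
  by apply: con; apply: leq_trans sn.
- move=> o o' /DE[->|[u [-> us _]]] /DE[->|[u' [-> us' _]]] //.
  + by move=> _; rewrite disjoint_sym; apply: disC.
  + by move=> _; apply: disC.
  + move=> uu'; rewrite disjoints_subset; apply/subsetP=> w; rewrite !inE => /eqP->.
    by apply: contraNneq uu' => /val_inj->.
- move=> o o' /DE[->|[u [-> us uC]]] /DE[->|[u' [-> us' uC']]] //.
  + by move=> _; rewrite adjacent_sym.
  + move=> uu'; apply: (cli s v) => //.
Qed.

(** [H] is the union of one geodesic from [x] to each [y i]. The vertex [x] is added separately so
    that [H] is nonempty even if [U] is empty, which accounts for the successor in the bound. *)
Lemma star_of_geodesics (I : finType) (R : {set G}) (x : G) (y : I -> G) (U : {set I}) :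
    x \in R -> {in U, forall i, y i \in component R x} ->
  exists H : {set G}, [/\ x \in H, H \subset component R x, {in U, forall i, y i \in H},
    connected_in H
    & forall v d, #|[set w in H | @dist_le (induced R) v w d]| <= #|U|.+1 * (2 * d + 1)].
Proof.
move=> xR yC.
have geo i : exists P : {set G}, i \in U -> [/\ x \in P, y i \in P,
    {in P, forall z, connect (induced_rel P) x z},
    {in P, forall z, connect (induced_rel R) x z}
    & {in P &, injective (@dist (induced R) x)}].
  have [iU|niU] := boolP (i \in U); last by exists set0.
  have := yC i iU; rewrite inE => /(@geodesic_set (induced R))[P [xP yP cP cR iP]].
  exists P => _; split=> // z zP; apply: connect_sub (cP z zP) => a b.
  by case/and3P=> aP bP /and3P[_ _ ab]; apply: connect1; rewrite /induced_rel /= aP bP ab.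
have {geo}[P geo] := fin_all_exists geo.
pose H := x |: \bigcup_(i in U) P i.
have PH i : i \in U -> P i \subset H.
  by move=> iU; rewrite /H subsetU // (bigcup_max i) // orbT.
have xH : x \in H by rewrite !inE eqxx.
exists H; split=> //.
- apply/subsetP=> z /setU1P[->|/bigcupP[i iU zP]]; first exact: component_refl.
  by case: (geo i iU) => _ _ _ cR _; rewrite inE; apply: cR.
- by move=> i iU; case: (geo i iU) => _ yP _ _ _; apply: (subsetP (PH i iU)).
- apply: (star_connected_in xH) => z /setU1P[->|/bigcupP[i iU zP]] //.
  case: (geo i iU) => _ _ cP _ _; exact: induced_connect_sub (PH i iU) (cP z zP).
- move=> v d.
  have sub : [set w in H | @dist_le (induced R) v w d] \subset
      x |: \bigcup_(i in U) [set w in P i | @dist_le (induced R) v w d].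
    apply/subsetP=> w; rewrite inE => /andP[/setU1P[->|/bigcupP[i iU wP]] vw].
      by rewrite !inE eqxx.
    by apply/setU1P; right; apply/bigcupP; exists i; rewrite // inE wP.
  apply: leq_trans (subset_leq_card sub) _.
  apply: leq_trans (leq_card_setU _ _) _; rewrite cards1 mulSn.
  apply: leq_add; first by rewrite addn1.
  apply: leq_trans (leq_card_bigcup _ _) _.
  rewrite -sum_nat_const; apply: leq_sum => i iU.
  case: (geo i iU) => _ _ _ cR iP.
  exact (@geodesic_ball (induced R) (P i) x v d cR iP).
Qed.


(** The new bag is a star of geodesics in the component of [x], reaching a neighbour of each bag
    that touches this component. There are at most [k] such bags. *)
Lemma decomposition_step k beta n x :
    ~ minor 'K_k.+2 G -> decomposition k beta n -> x \in level beta n ->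
  exists2 beta', decomposition k beta' n.+1
    & #|level beta' n.+1| < #|level beta n|.
Proof.
move=> noK dec xR; case: (dec) => le_n con geo cli.
set R := level beta n in xR; pose C := component R x.
pose U := touched beta n x n.
have Uk : #|U| <= k by apply: touched_card noK dec _ xR.
(* The value [x] for untouched bags is a dummy. *)
have yex (i : 'I_n) : exists y, i \in U ->
    y \in C /\ exists2 z, z \in bag beta i & z -- y.
  have [|_] := boolP (i \in U); last by exists x.
  by rewrite inE => /andP[_ /adjacentP[z [y [zi yC zy]]]]; exists y; split=> //; exists z.
have {yex}[y yP] := fin_all_exists yex.
have [|H [xH HC yH conH ballH]] := @star_of_geodesics _ R x y U xR.
  by move=> i /yP[].
have CR : C \subset R by apply: component_subset.
have HR : H \subset R by apply: subset_trans CR.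
(* [H] keeps the value [n]; the rest of [R], including its other components, moves on to [n.+1]. *)
pose beta' v := if v \in H then n else if v \in R then n.+1 else beta v.
have betaR v : (v \in R) = (beta v == n) by rewrite inE eqn_leq le_n.
have bag_old j : j < n -> bag beta' j = bag beta j.
  move=> jn; apply/setP=> v; rewrite !inE /beta'.
  case: ifP => [/(subsetP HR)|_]; first by rewrite betaR => /eqP->.
  case: ifP => //; rewrite betaR => /eqP->; rewrite !gtn_eqF //.
  exact: leq_trans jn _.
have bag_new : bag beta' n = H.
  apply/setP=> v; rewrite !inE /beta'; case: ifP => [_|_]; first exact: eqxx.
  by case: ifP => [_|]; rewrite ?betaR // gtn_eqF.
have level_old s : s <= n -> level beta' s = level beta s.
  move=> sn; apply/setP=> v; rewrite !inE /beta'.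
  case: ifP => [/(subsetP HR)|_]; first by rewrite betaR => /eqP->.
  by case: ifP => //; rewrite betaR => /eqP->; rewrite sn leqW.
have level_new : level beta' n.+1 = R :\: H.
  apply/setP=> v; rewrite in_setD inE /beta'.
  case: ifP => _; first by rewrite ltnn.
  by case: ifP => _; rewrite ?leqnn // ltnNge le_n.
(* A component of what remains that touches [H] lies in [C]. Hence a bag [u] touching it also
   touches [C], and [H] was built to contain a neighbour of that bag. *)
have newH v (u : nat) : u < n -> v \in R :\: H ->
    adjacent (bag beta u) (component (R :\: H) v) ->
    adjacent H (component (R :\: H) v) -> adjacent (bag beta u) H.
  move=> un vRH uv /adjacentP[a [b [aH bv ab]]].
  have vR : v \in R by case/setDP: vRH.
  have vx : component R v = C.
    rewrite -(component_eq (v := a) (u := v)); first last.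
      have bRv := subsetP (component_sub v (subsetDl R H)) b bv.
      have bR := subsetP (component_subset vR) b bRv.
      move: bRv; rewrite !inE => /connect_trans; apply; apply: connect1.
      by rewrite /induced_rel /= bR (subsetP HR a aH) adj_sym.
    exact/component_eq/(subsetP HC).
  have uU : Ordinal un \in U.
    have sub : component (R :\: H) v \subset C by rewrite -vx component_sub ?subsetDl.
    by rewrite inE /= un; apply: adjacentS sub uv.
  have [_ [z zu zy]] := yP _ uU.
  by apply/adjacentP; exists z, (y (Ordinal un)); split=> //; apply: yH.
exists beta'; last first.
  rewrite level_new; apply: proper_card; rewrite properE subsetDl.
  by apply/subsetPn; exists x; rewrite // in_setD xH.
split.
- move=> v; rewrite /beta'; case: ifP => _ //; case: ifP => _ //.
  exact: leqW.
- move=> j; rewrite ltnS leq_eqVlt => /orP[/eqP->|jn]; first by rewrite bag_new.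
  by rewrite bag_old //; apply: con.
- move=> j v d; rewrite ltnS leq_eqVlt => /orP[/eqP->|jn].
    rewrite bag_new level_old //; apply: leq_trans (ballH v d) _.
    by rewrite leq_mul2r ltnS Uk orbT.
  by rewrite bag_old // level_old ?(ltnW jn) //; apply: geo.
- move=> s v u u'; rewrite leq_eqVlt => /orP[/eqP->|].
    rewrite level_new !ltnS (leq_eqVlt u) (leq_eqVlt u') => vRH.
    have vR : v \in R by case/setDP: vRH.
    have up (w : nat) : adjacent (bag beta w) (component (R :\: H) v) ->
        adjacent (bag beta w) (component R v).
      by apply: adjacentS; rewrite component_sub ?subsetDl.
    case/orP=> [/eqP->|un] /orP[/eqP->|un']; rewrite ?eqxx // => uu';
      rewrite ?bag_new ?bag_old //.
    + by move=> nv uv; rewrite adjacent_sym; apply: newH uv nv.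
    + by move=> uv nv; apply: newH uv nv.
    + by move=> /up uv /up u'v; apply: cli u'v.
  rewrite ltnS => sn; rewrite level_old // => vs us us'.
  rewrite !bag_old ?(leq_trans us) ?(leq_trans us') //; exact: cli.
Qed.

(** Starting from no bag and every vertex unplaced, each step shrinks the set of unplaced vertices,
    so it eventually becomes empty. *)
Lemma decomposition_exists k : ~ minor 'K_k.+2 G ->
  exists beta n, decomposition k beta n /\ forall v, beta v < n.
Proof.
move=> noK.
suff ex m beta n : #|level beta n| < m -> decomposition k beta n ->
    exists beta n, decomposition k beta n /\ forall v, beta v < n.
  apply: (ex _ (fun _ => 0) 0 (ltnSn _)).
  by split=> // s v u u'; rewrite leqn0 => /eqP->.
elim: m beta n => [//|m IHm] beta n le_m dec.
have [R0|[x xR]] := set_0Vmem (level beta n).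
  exists beta, n; split=> // v; rewrite ltnNge; apply/negP=> nv.
  by have := in_set0 v; rewrite -R0 inE nv.
have [beta' dec' lt] := decomposition_step noK dec xR.
exact: IHm (leq_trans lt le_m) dec'.
Qed.

End Decomposition.

(** * Counting hubs, and distances witnessed by hubs *)

Section Hubs.
Variables (G : sgraph) (k : nat) (beta : G -> nat) (n : nat).
Hypothesis noK : ~ minor 'K_k.+2 G.
Hypothesis dec : decomposition k beta n.
Hypothesis beta_lt : forall v, beta v < n.
Implicit Types (v w : G) (d e s q : nat).

Definition level_dist_le s v w e := @dist_le (induced (level beta s)) v w e.

Definition near_bag v e q :=
  [exists w in bag beta q, level_dist_le q v w e].

Lemma near_bagP v e q :
  reflect (exists2 w, beta w = q & level_dist_le q v w e) (near_bag v e q).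
Proof.
apply: (iffP exists_inP) => [[w]|[w wq vw]].
  by rewrite inE => /eqP wq vw; exists w.
by exists w => //; rewrite inE wq.
Qed.

Lemma near_bag_monotone v e q : near_bag v e q -> near_bag v e.+1 q.
Proof.
move=> /near_bagP[w wq vw]; apply/near_bagP; exists w => //.
exact: dist_le_monotone vw.
Qed.

Lemma near_bag_level v e q : near_bag v e q -> q <= beta v.
Proof.
case/near_bagP=> w wq; rewrite /level_dist_le dist_le_sym => /dist_le_in.
by rewrite !inE wq leqnn; apply.
Qed.

(** Consider the first vertex outside level [s] on a walk from [v], and let [q] be its bag. The walk
    up to that vertex lies in level [q], so it shows that [q] is near. *)
Lemma level_exit v s s' y e : s' <= s -> s <= beta v ->
    level_dist_le s' v y e ->
  level_dist_le s v y e \/ exists2 q, s' <= q < s & near_bag v e q.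
Proof.
move=> ss sv; elim: e y => [|e IHe] y.
  by rewrite /level_dist_le !dist_le0; left.
case/induced_distS=> [/IHe[vy|[q sq nq]]|[x [/IHe + _ + xy]]].
- by left; apply: dist_le_monotone vy.
- by right; exists q; last exact: near_bag_monotone nq.
case=> [vx|[q sq nq] _]; last by right; exists q; last exact: near_bag_monotone nq.
rewrite inE => ys'.
have xs : x \in level beta s by apply: dist_le_in vx _; rewrite inE.
have [sy|ys] := leqP s (beta y).
  by left; apply: induced_dist_step vx xs _ xy; rewrite inE.
right; exists (beta y); first by rewrite ys' ys.
have sub : level beta s \subset level beta (beta y) by apply/level_sub/ltnW.
apply/near_bagP; exists y => //.
by apply: induced_dist_step (dist_le_sub sub vx) (subsetP sub x xs) _ xy; rewrite inE.
Qed.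

(** These are the bags before [s] adjacent to the ball of radius [e] around [v] in level [s]. Their
    number, at most [k], serves as a potential. *)
Definition reached_below v s e : {set 'I_n} :=
  [set u : 'I_n | (u < s) &&
     [exists y, level_dist_le s v y e && [exists z in bag beta u, y -- z]]].

Lemma reached_belowP v s e (u : 'I_n) :
  reflect [/\ u < s & exists y z, [/\ level_dist_le s v y e, beta z = u & y -- z]]
          (u \in reached_below v s e).
Proof.
rewrite inE; apply: (iffP andP) => -[us].
  case/existsP=> y /andP[vy /exists_inP[z]]; rewrite inE => /eqP zu yz.
  by split=> //; exists y, z.
case=> y [z [vy zu yz]]; split=> //; apply/existsP; exists y; rewrite vy /=.
by apply/exists_inP; exists z; rewrite // inE zu.
Qed.

Lemma reached_below_card v s e : s <= n -> s <= beta v ->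
  #|reached_below v s e| <= k.
Proof.
move=> sn sv; have vs : v \in level beta s by rewrite inE.
apply: leq_trans (touched_card n noK dec sn vs).
apply: subset_leq_card; apply/subsetP=> u /reached_belowP[us [y [z [vy zu yz]]]].
rewrite inE us; apply/adjacentP; exists z, y; split.
- by rewrite inE zu.
- by rewrite inE; apply: dist_le_connect vy.
- by rewrite adj_sym.
Qed.

(* The separating radius is the distance from v to the nearest bag q with
   s' <= q < s: below that radius nothing is gained when passing from s to s',
   and q is lost. *)
Lemma reached_below_lt v d s s' : s' < s -> s <= beta v -> near_bag v d s' ->
  exists2 e, e < d & #|reached_below v s' e| < #|reached_below v s e|.
Proof.
move=> ss sv near_s'.
pose P e := [exists q : 'I_n, (s' <= q < s) && near_bag v e q].
have PI e q : s' <= q < s -> near_bag v e q -> P e.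
  move=> sq nq; have qn : q < n.
    by case/andP: sq => _ /leq_trans; apply; apply: leq_trans sv (ltnW (beta_lt v)).
  by apply/existsP; exists (Ordinal qn); rewrite /= sq nq.
have exP : exists e, P e by exists d; apply: PI near_s'; rewrite leqnn.
(* The minimum is not 0, since [v] itself lies in no bag before [s]. Written as [e.+1], it gives the
   separating radius [e]. *)
case: (ex_minnP exP) => -[|e] /existsP[q /andP[sq nq]] min_e.
  case/near_bagP: nq => w wq; rewrite /level_dist_le dist_le0 => /eqP vw.
  by case/andP: sq => _; rewrite -wq -vw ltnNge sv.
have ed : e < d by apply: min_e; apply: PI near_s'; rewrite leqnn.
have notP r : s' <= r < s -> ~ near_bag v e r.
  by move=> sr /(PI _ _ sr)/min_e; rewrite ltnn.
have stay y r : s' <= r < s -> level_dist_le r v y e -> level_dist_le s v y e.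
  case/andP=> s'r rs vy; have [//|[q' /andP[rq' q's] nq']] := level_exit (ltnW rs) sv vy.
  by case: (@notP q') => //; rewrite (leq_trans s'r rq').
exists e => //; apply: proper_card; rewrite properE; apply/andP; split.
  apply/subsetP=> u /reached_belowP[us [y [z [vy zu yz]]]].
  apply/reached_belowP; split; first exact: ltn_trans us ss.
  by exists y, z; split=> //; apply: stay vy; rewrite leqnn.
case/andP: (sq) => s'q qs.
(* The nearest bag [q] is lost: it is adjacent to the ball of radius [e] in level [s], but its index
   is not below [s']. *)
apply/subsetPn; exists q; last by apply/negP=> /reached_belowP[]; rewrite ltnNge s'q.
case/near_bagP: nq => w wq /induced_distS[vw|[y [vy _ _ yw]]].
  by case: (@notP q) => //; apply/near_bagP; exists w.
apply/reached_belowP; split=> //; exists y, w; split=> //.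
exact: stay vy.
Qed.

(** Send a near bag [q] to the sizes of [reached_below v q e] for [e < d]. These sequences are
    nondecreasing with values in 0, ..., k, and [reached_below_lt] makes them distinct for distinct
    bags; the binomial counts such sequences. *)
Lemma near_bag_card v d :
  #|[set q : 'I_n | near_bag v d q]| <= 'C(d + k, d).
Proof.
pose c (q : 'I_n) (e : 'I_d) : 'I_k.+1 := inord #|reached_below v q e|.
pose f (q : 'I_n) := [tuple c q e | e < d].
have cE (q : 'I_n) (e : 'I_d) : near_bag v d q -> c q e = #|reached_below v q e| :> nat.
  move=> /near_bag_level qv; rewrite inordK // ltnS.
  exact: reached_below_card (ltnW (ltn_ord q)) qv.
rewrite -card_sorted_tuples -(@card_in_imset _ _ f); last first.
  have sep (q q' : 'I_n) : near_bag v d q -> near_bag v d q' -> q' < q -> f q != f q'.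
    move=> nq nq' qq'; apply/eqP=> ff.
    have [e ed] := reached_below_lt qq' (near_bag_level nq) nq'.
    have := congr1 (fun t => tnth t (Ordinal ed)) ff.
    rewrite !tnth_mktuple => /(congr1 (@nat_of_ord _)); rewrite !cE //= => ->.
    by rewrite ltnn.
  move=> q q'; rewrite !inE => nq nq' ff.
  apply/val_inj; case: (ltngtP q q') => // lt_q.
    by have := sep _ _ nq' nq lt_q; rewrite ff eqxx.
  by have := sep _ _ nq nq' lt_q; rewrite ff eqxx.
apply: subset_leq_card; apply/subsetP=> _ /imsetP[q nq ->]; rewrite inE in nq.
rewrite inE; apply/(sortedP 0) => i; rewrite size_map size_tuple => id.
have id' := ltnW id.
rewrite !(nth_map ord0) ?size_tuple // /f.
rewrite -(tnth_nth ord0 (f q) (Ordinal id)) -(tnth_nth ord0 (f q) (Ordinal id')).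
rewrite !tnth_mktuple -[leqLHS]/(nat_of_ord _) -[leqRHS]/(nat_of_ord _) !cE //.
apply: subset_leq_card; apply/subsetP=> u.
case/reached_belowP=> uq [y [z [vy zu yz]]]; apply/reached_belowP; split=> //.
by exists y, z; split=> //; apply: dist_le_monotone vy.
Qed.

Definition hubs v d : {set G} := [set w | level_dist_le (beta w) v w d].

Lemma hubs_card v d : #|hubs v d| <= 'C(d + k, d) * (k.+1 * (2 * d + 1)).
Proof.
have [_ _ geo _] := dec.
have sub : hubs v d \subset \bigcup_(q : 'I_n | near_bag v d q)
    [set w in bag beta q | level_dist_le q v w d].
  apply/subsetP=> w; rewrite inE => vw; apply/bigcupP; exists (Ordinal (beta_lt w)).
    by apply/near_bagP; exists w.
  by rewrite !inE eqxx.
apply: leq_trans (subset_leq_card sub) _; apply: leq_trans (leq_card_bigcup _ _) _.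
apply: (@leq_trans (\sum_(q : 'I_n | near_bag v d q) k.+1 * (2 * d + 1))).
  by apply: leq_sum => q _; apply: geo.
by rewrite sum_nat_cond_const leq_mul2r near_bag_card orbT.
Qed.

(** The hub is a vertex of smallest [beta] on the walk, whose level contains the whole walk.
    Extending the walk by a vertex either keeps the hub or, if the new vertex has smaller [beta],
    replaces it. *)
Lemma hub_exists u v m : dist_le u v m ->
  exists w x y, [/\ x + y <= m, level_dist_le (beta w) u w x
                              & level_dist_le (beta w) v w y].
Proof.
elim: m v => [|m IHm] v.
  by rewrite dist_le0 => /eqP<-; exists u, 0, 0; rewrite /level_dist_le !dist_le0.
case/dist_leS=> [/IHm[w [x [y [xy uw vw]]]]|[v' /IHm[w [x [y [xy uw v'w]]]] v'v]].
  by exists w, x, y; rewrite leqW.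
have v'R : v' \in level beta (beta w).
  by move: v'w; rewrite /level_dist_le dist_le_sym => /dist_le_in; apply; rewrite inE.
have [wv|vw] := leqP (beta w) (beta v).
  exists w, x, y.+1; rewrite addnS; split=> //.
  rewrite /level_dist_le dist_le_sym.
  apply: induced_dist_step v'v; rewrite ?inE ?wv //; last by rewrite inE in v'R.
  by rewrite dist_le_sym.
exists v, (x + y).+1, 0; rewrite addn0; split=> //; last exact: dist_le_refl.
have sub : level beta (beta w) \subset level beta (beta v) by apply/level_sub/ltnW.
apply: (induced_dist_step (w := v')) => //; first last.
- by rewrite inE.
- exact: (subsetP sub).
- apply: dist_le_sub sub _; apply: dist_le_trans uw _.
  by rewrite dist_le_sym.
Qed.

End Hubs.

(** * Bounding a ladder whose relation is witnessed by few labelled hubs *)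

Section LabelledLadder.
Variables (W : finType) (l c d : nat) (f g : 'I_l -> W -> option nat).

Definition short (o : option nat) m := if o is Some x then x <= m else false.

(** In the application [g i w] and [f j w] are the distances of [b i] and [a j] to [w] in the level
    of [w]. *)
Definition meet i j :=
  exists w x y, [/\ g i w = Some x, f j w = Some y & x + y <= d].

Hypothesis f_card : forall i, #|[set w | short (f i w) d]| <= c.
Hypothesis g_card : forall i, #|[set w | short (g i w) d]| <= c.
Hypothesis meet_lt : forall i j : 'I_l, i < j -> meet i j.
Hypothesis not_meet : forall i, ~ meet i i.

(** A meeting of [i] and [j] at a hub in [F] would also be a meeting of [i] with itself, because
    [f i] and [f j] agree there. *)
Lemma meet_outside (F : {set W}) (X : {set 'I_l}) (i j : 'I_l) :
    {in X &, forall j j', {in F, f j =1 f j'}} -> i \in X -> j \in X ->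
    i <= j -> j != i ->
  exists w y, [/\ w \notin F, short (g i w) d, f j w = Some y & y <= d].
Proof.
move=> eqF iX jX le_ij ji; have [w [x [y [gx fy xy]]]] : meet i j.
  by apply: meet_lt; rewrite ltn_neqAle eq_sym ji.
exists w, y; rewrite gx /= (leq_trans _ xy) ?leq_addr // (leq_trans _ xy) ?leq_addl //.
split=> //; apply/negP=> wF; apply: (@not_meet i); exists w, x, y; split=> //.
by rewrite (eqF i j).
Qed.

(* If all [f j], j in X, agree on F, then the least i in X can meet the other
   indices only at hubs outside F.  Fixing such a hub and its label enlarges F,
   and F cannot outgrow the bound c. *)
Lemma ladder_branching m (F : {set W}) (X : {set 'I_l}) :
    {in X, forall j, F \subset [set w | short (f j w) d]} ->
    {in X &, forall j j', {in F, f j =1 f j'}} ->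
    c <= #|F| + m ->
  #|X| <= (c * d.+1).+1 ^ m.
Proof.
elim: m F X => [|m IHm] F X subF eqF cF;
  have [->|[i0 i0X]] := set_0Vmem X; rewrite ?cards0 //;
  case: (arg_minnP (@nat_of_ord l) i0X) => i iX min_i {i0 i0X};
  have new j jX := @meet_outside F X i j eqF iX jX (min_i j jX).
  (* For [m = 0], [F] already contains every hub of each [j] in [X], so only [i] can be in [X]. *)
  rewrite expn0 -(cards1 i); apply: subset_leq_card; apply/subsetP=> j jX.
  rewrite inE; apply/negPn/negP=> /(new j jX)[w [y [wF _ fy yd]]]; case/negP: wF.
  have /eqP-> : F == [set w | short (f j w) d].
    by rewrite eqEcard subF //; apply: leq_trans (f_card j) _; rewrite addn0 in cF.
  by rewrite inE fy.
(* Pigeonhole over the at most [c * d.+1] pairs of a hub of [g i] and a label. On each class [Y p]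
   the label at [p.1] is constant, so [p.1] can join [F]. *)
pose H := setX [set w | short (g i w) d] [set: 'I_d.+1].
pose Y (p : W * 'I_d.+1) :=
  [set j in X | (p.1 \notin F) && (f j p.1 == Some (val p.2))].
have cover : X \subset i |: \bigcup_(p in H) Y p.
  apply/subsetP=> j jX; have [->|ji] := eqVneq j i; first by rewrite !inE eqxx.
  have [w [y [wF gw fy yd]]] := new j jX ji.
  apply/setU1P; right; apply/bigcupP; exists (w, inord y); first by rewrite !inE gw.
  by rewrite !inE jX wF /= fy inordK.
have small p : #|Y p| <= (c * d.+1).+1 ^ m.
  case: p => w y; have [wF|wF] := boolP (w \in F).
    by rewrite (_ : Y _ = set0) ?cards0 //; apply/setP=> j; rewrite !inE /= wF andbF.
  apply: (IHm (w |: F)) => [j|j j'|]; last by rewrite cardsU1 wF add1n addSnnS.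
  + rewrite !inE /= => /and3P[jX _ /eqP fj]; rewrite subUset subF // andbT sub1set.
    by rewrite inE fj /= -ltnS.
  + rewrite !inE /= => /and3P[jX _ /eqP fj] /and3P[jX' _ /eqP fj'] v /setU1P[->|vF].
      by rewrite fj fj'.
    exact: eqF.
apply: leq_trans (subset_leq_card cover) _.
apply: leq_trans (leq_card_setU _ _) _; rewrite cards1 expnS mulSn.
apply: leq_add; first by rewrite expn_gt0.
apply: leq_trans (leq_card_bigcup _ _) _.
apply: (@leq_trans (\sum_(p in H) (c * d.+1).+1 ^ m)); first exact: leq_sum.
by rewrite sum_nat_const cardsX cardsT card_ord !leq_mul.
Qed.

Lemma ladder_length : l <= (c * d.+1).+1 ^ c.
Proof.
rewrite -[X in X <= _]card_ord -cardsT.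
by apply: (@ladder_branching c set0) => [j _|j j' _ _ w|];
  rewrite ?sub0set ?inE ?cards0.
Qed.

End LabelledLadder.

(** * Numerical estimates and the final bound *)

Lemma leq_bin_exp d k : 'C(d + k, d) <= d.+1 ^ k.
Proof.
rewrite -bin_sub ?leq_addr // addKn.
elim: k => [|k IHk]; first by rewrite bin0.
(* (k+1) C(d+k+1, k+1) = (d+k+1) C(d+k, k), and d+k+1 is at most (k+1)(d+1). *)
rewrite -(leq_pmul2l (ltn0Sn k)) addnS -mul_bin_diag expnS mulnA leq_mul //.
by rewrite mulSn -addSn leq_add2l leq_pmulr.
Qed.

(** Label hubs by distances in their levels. These are at least the distances in [G], so a meeting
    of [i] with itself would contradict that [b i] is far from [a i]. *)
Lemma semi_ladder_order (G : sgraph) k d l : ~ minor 'K_k.+2 G ->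
    contains_semi_ladder G d l ->
  l <= (k.+1 * (2 * d + 1) ^ k.+1 * d.+1).+1 ^ (k.+1 * (2 * d + 1) ^ k.+1).
Proof.
move=> noK [a [b [_ _ _ near far]]].
have [beta [n [dec beta_lt]]] := decomposition_exists noK.
set c := k.+1 * _.
have hub_c v : #|hubs beta v d| <= c.
  apply: leq_trans (hubs_card noK dec beta_lt v d) _.
  rewrite /c expnS mulnCA leq_mul2l /= mulnC leq_mul2l; apply/orP; right.
  apply: leq_trans (leq_bin_exp d k) _.
  (* The case k = 0 is separate because comparing powers by their bases needs a positive
     exponent. *)
  by case: (k) => // k'; rewrite leq_exp2r // addn1 ltnS leq_pmull.
pose h v w := @dist (induced (level beta (beta w))) v w.
apply: (@ladder_length G l c d (fun i => h (a i)) (fun i => h (b i))) => [i|i|i j ij|i].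
- exact: hub_c.
- exact: hub_c.
- have [w [x [y [xy]]]] := hub_exists beta (near i j ij).
  rewrite /level_dist_le /dist_le -/(h _ _) -/(h _ _).
  case hx: (h _ _) => [x'|//] lx; case hy: (h _ _) => [y'|//] ly.
  by exists w, x', y'; split=> //; apply: leq_trans (leq_add lx ly) xy.
- move=> [w [x [y [hx hy xy]]]]; have /negP[] := far i.
  apply: (dist_le_monotone xy); apply: (@dist_le_trans _ _ w).
    by apply: (@dist_le_induced _ (level beta (beta w))); rewrite /dist_le -/(h _ _) hx.
  rewrite dist_le_sym.
  by apply: (@dist_le_induced _ (level beta (beta w))); rewrite /dist_le -/(h _ _) hy.
Qed.

(** The left side is at most t (2d+1)^t; then t < d^t and 2d+1 <= d^3, both from d >= 2, give d^t
    d^(3t). *)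
Lemma ladder_base_le t d : 0 < t -> 1 < d ->
  (t.-1 * (2 * d + 1) ^ t.-1 * d.+1).+1 <= d ^ (4 * t).
Proof.
case: t => // k _ d1.
have d3 : 2 * d + 1 <= d ^ 3.
  rewrite !expnS expn0 muln1 mulnA; apply: (@leq_trans (4 * d)).
    by rewrite (mulnDl 2 2) leq_add2l muln_gt0 (ltnW d1).
  by rewrite leq_mul2r (leq_mul d1 d1) orbT.
apply: (@leq_trans (k.+1 * (2 * d + 1) ^ k.+1)).
  rewrite mulSn -add1n leq_add ?expn_gt0 ?addn1 //= -mulnA expnSr !leq_mul //.
  by rewrite ltnS leq_addr.
rewrite (mulnDl 1 3) mul1n expnD leq_mul //; first exact/ltnW/ltn_expl.
by rewrite expnM leq_exp2r.
Qed.

Theorem theorem6p19 :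
  exists p : {poly nat},
    forall t d : nat, 4 <= t -> 2 <= d ->
    forall G : sgraph, ~ minor 'K_t G ->
    forall l : nat, d ^ (p.[t]%R * (2 * d + 1) ^ (t - 1)) < l ->
    ~ contains_semi_ladder G d l.
Proof.
(* The base contributes 4t to the exponent of [d] and the number of hubs a factor t - 1 <= t, whence
   4t^2. *)
exists (4 *: 'X^2)%R => t d t4 d2 G noK l; rewrite ltnNge => /negP lt_l lad; apply: lt_l.
case: t t4 noK => [|[|k]] // t4 noK.
apply: leq_trans (semi_ladder_order noK lad) _.
rewrite hornerZ hornerXn subn1 /=.
apply: leq_trans (_ : (d ^ (4 * k.+2)) ^ (k.+1 * (2 * d + 1) ^ k.+1) <= _).
  by rewrite leq_exp2r ?(@ladder_base_le k.+2) // muln_gt0 expn_gt0 addn1.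
rewrite -expnM leq_exp2l // mulnA leq_mul2r; apply/orP; right.
rewrite -mulnA; exact: leq_mul (leqnn 4) (leq_mul (leqnn k.+2) (leqnSn k.+1)).
Qed.
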